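(* Let $R$ be a ring with identity (not necessarily commutative). Then the undirected graph $\overline{\mathrm{APOG}}(R)$ is a complete graph if and only if at least one of the following holds: (i) $(D(R))^{2}=0$; (ii) $R$ is a direct product of two division rings; (iii) $R$ is a local ring with maximal ideal $\mathfrak{m}$ such that $\mathrm{IPO}(R)=\{0,\mathfrak{m},\mathfrak{m}^{2},R\}$.
   Context: $D(R)$ is the set of one-sided zero-divisors of $R$ (including $0$): the nonzero $a\in D(R)$ are those for which there is a nonzero $b\in R$ with $ab=0$ or $ba=0$. $(D(R))^2=0$ means $xy=0$ for all $x,y\in D(R)$. $\mathrm{IPO}(R)$ is the set of all $A\subseteq R$ of the form $A=IJ$ where each of $I,J$ is a left or a right ideal of $R$; the product of additive subgroups is the set of finite sums of products. $\mathrm{IPO}(R)$ is a semigroup with zero under this product. $\overline{\mathrm{APOG}}(R)$ is the undirected graph whose vertices are the nonzero $A\in\mathrm{IPO}(R)$ for which there is a nonzero $B\in\mathrm{IPO}(R)$ with $AB=0$ or $BA=0$; two distinct vertices $A,B$ are adjacent iff $AB=0$ or $BA=0$. A graph is complete if any two distinct vertices are adjacent (the graph with no vertices counts as complete). *)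

(* Defs.v *)
From HB Require Import structures.
From mathcomp Require Import all_boot all_order all_algebra.
From mathcomp Require Import boolp classical_sets.

Set Implicit Arguments.
Unset Strict Implicit.
Unset Printing Implicit Defensive.

Import GRing.Theory.

Local Open Scope classical_set_scope.
Local Open Scope ring_scope.

Record ugraph (T : Type) := UGraph {
  vertices : set T;
  adjacent : T -> T -> Prop;
  adjacent_sym : forall x y, adjacent x y -> adjacent y x;
  adjacent_irr : forall x, ~ adjacent x x
}.

Definition complete_graph (T : Type) (G : ugraph T) : Prop :=
  forall x y, vertices G x -> vertices G y -> x <> y -> adjacent G x y.

Section Ideals.
Variable R : pzRingType.
Implicit Types A B I J m : set R.

Definition left_ideal I : Prop :=
  [/\ I 0, forall x y, I x -> I y -> I (x - y)
    & forall r x, I x -> I (r * x)].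

Definition right_ideal I : Prop :=
  [/\ I 0, forall x y, I x -> I y -> I (x - y)
    & forall r x, I x -> I (x * r)].

Definition subgroup_mul A B : set R :=
  [set x | exists (n : nat) (a b : 'I_n -> R),
     (forall i, A (a i) /\ B (b i)) /\ x = \sum_(i < n) a i * b i].

Definition IPO : set (set R) :=
  [set A | exists I J, [/\ left_ideal I \/ right_ideal I,
                           left_ideal J \/ right_ideal J
                         & A = subgroup_mul I J]].

Definition zero_divisors : set R :=
  [set a | a = 0 \/ exists b, b <> 0 /\ (a * b = 0 \/ b * a = 0)].

Definition annihilate A B : Prop :=
  subgroup_mul A B = [set 0] \/ subgroup_mul B A = [set 0].

Definition APOG_vertices : set (set R) :=
  [set A | [/\ IPO A, A <> [set 0]
             & exists B, [/\ IPO B, B <> [set 0] & annihilate A B]]].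

Definition APOG_adjacent A B : Prop :=
  [/\ APOG_vertices A, APOG_vertices B, A <> B & annihilate A B].

Lemma APOG_adjacent_sym A B : APOG_adjacent A B -> APOG_adjacent B A.
Proof.
case=> vA vB neqAB annAB; split=> //; first by move=> eqBA; apply: neqAB.
by case: annAB; [right | left].
Qed.

Lemma APOG_adjacent_irr A : ~ APOG_adjacent A A.
Proof. by case. Qed.

Definition APOG : ugraph (set R) :=
  @UGraph _ APOG_vertices APOG_adjacent APOG_adjacent_sym APOG_adjacent_irr.

Definition maximal_left_ideal m : Prop :=
  [/\ left_ideal m, m <> [set: R]
    & forall I, left_ideal I -> m `<=` I -> I = m \/ I = [set: R]].

(* The unique maximal left ideal of a local ring is two-sided and is also its
   unique maximal right ideal, so the left-handed definition loses nothing. *)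
Definition local_with_maximal_ideal m : Prop :=
  maximal_left_ideal m /\ forall m', maximal_left_ideal m' -> m' = m.

Definition is_division_ring : Prop :=
  (1 : R) <> 0 /\
  forall x : R, x <> 0 -> exists y, x * y = 1 /\ y * x = 1.

End Ideals.

Arguments IPO : clear implicits.
Arguments zero_divisors : clear implicits.
Arguments APOG : clear implicits.
Arguments is_division_ring : clear implicits.

(* Main.v *)
Require Import Defs.
From HB Require Import structures.
From mathcomp Require Import all_boot all_order all_algebra.
From mathcomp Require Import boolp classical_sets.

(** The three kinds of rings have complete graphs for simple reasons. If
    [D(R)^2 = 0], all vertices consist of zero-divisors, hence multiply to [0].
    In a product of two division rings the only vertices are the two factors.
    If [IPO(R) = {0, m, m^2, R}], the only possible vertices are [m] and [m^2];
    for [m] to be a vertex while [m] and [m^2] are nonzero, [m^3] must vanish.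

    Conversely, suppose the graph is complete. If [a * b = 0] with [b <> 0],
    then [Ra * bR = 0], so [Ra] and [bR] are annihilated (and [R] never is).
    Completeness thus becomes a statement on elements: two such principal
    ideals are equal or one of their two products is zero
    ([complete_left_left], [complete_right_right], [complete_left_right]).
    Everything else is drawn from these trichotomies.

    - If [e] is an idempotent other than [0] and [1], then [Re * eR] and
      [eR * Re] both contain [e], so [Re = eR] and [e] is central; any nonzero
      [a] in [Re] satisfies [Ra = Re] for the same reason, so [eR] and
      [(1 - e)R] are division rings and [R] is their product.

    - Otherwise every one-sided zero-divisor satisfies [x^3 = 0]: comparing
      [Rx] with [Rx^2] shows that [x^3 <> 0] would make [Rx = Rx^2], which
      produces an idempotent. Hence zero-divisors are two-sided, and they form
      a two-sided ideal [D]. If [D^2 <> 0], there is [x] in [D] with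
      [x^2 <> 0]. Then [Rx = xR], and either [D x^2 = 0] or [x^2 D = 0], so [D]
      itself is annihilated; comparing it with [Rx] gives [D = Rx = xR].
      Elements outside [D] turn out to be units. Therefore [R] is local, its
      one-sided ideals are [0], [Rx], [Rx^2] and [R], and products of these
      add nothing new. *)

Set Implicit Arguments.
Unset Strict Implicit.
Unset Printing Implicit Defensive.

Import GRing.Theory.

Local Open Scope classical_set_scope.
Local Open Scope ring_scope.

(** * Products of one-sided ideals *)

Section Products.
Variable R : pzRingType.
Implicit Types (A B I J : set R) (a b x y : R).

Lemma mem_subgroup_mul A B a b : A a -> B b -> subgroup_mul A B (a * b).
Proof.
move=> Aa Bb; exists 1, (fun=> a), (fun=> b); split=> //.
by rewrite big_ord1.
Qed.

Lemma subgroup_mul0 A B : subgroup_mul A B 0.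
Proof.
by exists 0, (fun=> 0), (fun=> 0); split=> [[]|] //; rewrite big_ord0.
Qed.

(** Reduces a property of the elements of [A B] that is stable under sums to
    products of one element of each. *)
Lemma subgroup_mul_ind A B (P : R -> Prop) :
    P 0 -> (forall x y, P x -> P y -> P (x + y)) ->
    (forall a b, A a -> B b -> P (a * b)) ->
  forall x, subgroup_mul A B x -> P x.
Proof.
move=> P0 PD Pab _ [n [a [b [ABab ->]]]].
by apply: (big_ind P) => // i _; have [] := ABab i; apply: Pab.
Qed.

Lemma subgroup_mulD A B x y :
  subgroup_mul A B x -> subgroup_mul A B y -> subgroup_mul A B (x + y).
Proof.
move=> [n [a [b [ABab ->]]]] [k [c [d [ABcd ->]]]].
exists (n + k)%N.
exists (fun i => match split i with inl j => a j | inr j => c j end).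
exists (fun i => match split i with inl j => b j | inr j => d j end).
split=> [i|]; first by case: (split i).
rewrite big_split_ord /=; congr (_ + _); apply: eq_bigr => i _.
  by rewrite (unsplitK (inl i : 'I_n + 'I_k)).
by rewrite (unsplitK (inr i : 'I_n + 'I_k)).
Qed.

Lemma subgroup_mul_eq0 A B :
  subgroup_mul A B = [set 0] <-> (forall a b, A a -> B b -> a * b = 0).
Proof.
split=> [AB0 a b Aa Bb | AB0].
  by have := mem_subgroup_mul Aa Bb; rewrite AB0.
apply/seteqP; split=> [|_ ->]; last exact: subgroup_mul0.
by apply: subgroup_mul_ind => [|_ _ -> ->|a b /AB0 h /h] //=; rewrite addr0.
Qed.

Definition one_sided I := left_ideal I \/ right_ideal I.

Lemma one_sided0 I : one_sided I -> I 0.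
Proof. by case=> -[]. Qed.

Lemma one_sidedB I x y : one_sided I -> I x -> I y -> I (x - y).
Proof. by case=> -[_ h _]; apply: h. Qed.

Lemma one_sidedD I x y : one_sided I -> I x -> I y -> I (x + y).
Proof.
move=> sI Ix Iy; rewrite -[y]opprK; apply: (one_sidedB sI) => //.
by rewrite -sub0r; apply: (one_sidedB sI) => //; apply: one_sided0.
Qed.

Lemma left_ideal_setT : left_ideal [set: R]. Proof. by []. Qed.

Lemma subgroup_mulTl I : left_ideal I -> subgroup_mul [set: R] I = I.
Proof.
move=> lI; have [I0 _ Im] := lI; apply/seteqP; split=> x.
  apply: subgroup_mul_ind => // [u v|a b _]; last exact: Im.
  by apply: one_sidedD; left.
by move=> Ix; rewrite -[x]mul1r; apply: mem_subgroup_mul.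
Qed.

Lemma subgroup_mulTr I : right_ideal I -> subgroup_mul I [set: R] = I.
Proof.
move=> rI; have [I0 _ Im] := rI; apply/seteqP; split=> x.
  apply: subgroup_mul_ind => // [u v|a b Ia _]; last exact: Im.
  by apply: one_sidedD; right.
by move=> Ix; rewrite -[x]mulr1; apply: mem_subgroup_mul.
Qed.

Lemma left_ideal_subgroup_mul I J :
  left_ideal I -> left_ideal (subgroup_mul I J).
Proof.
case=> _ _ Im.
have Zm r x : subgroup_mul I J x -> subgroup_mul I J (r * x).
  move: x; apply: subgroup_mul_ind => [|u v|a b Ia Jb].
  - by rewrite mulr0; apply: subgroup_mul0.
  - by rewrite mulrDr; apply: subgroup_mulD.
  - by rewrite mulrA; apply: mem_subgroup_mul => //; apply: Im.
split=> // [|x y Ix Iy]; first exact: subgroup_mul0.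
by apply: subgroup_mulD => //; rewrite -mulN1r; apply: Zm.
Qed.

(** A left ideal absorbs [R] on its left, and a right ideal on its right; this
    is where the identity of [R] puts every one-sided ideal in [IPO R]. *)
Lemma IPO_one_sided I : one_sided I -> IPO R I.
Proof.
case=> sI.
- by exists [set: R], I; split; [left | left | rewrite subgroup_mulTl].
- by exists I, [set: R]; split; [right | left | rewrite subgroup_mulTr].
Qed.

Lemma nonzero_mem I x : I x -> x <> 0 -> I <> [set 0].
Proof. by move=> Ix x0 I0; move: Ix; rewrite I0. Qed.

Lemma exists_nonzero I : I 0 -> I <> [set 0] -> exists2 x, I x & x <> 0.
Proof.
move=> I0 nI; apply: contrapT => nx; apply: nI.
apply/seteqP; split=> [x Ix|_ ->//].
by apply: contrapT => x0; apply: nx; exists x.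
Qed.

Lemma IPO0 A : IPO R A -> A 0.
Proof. by case=> I [J [_ _ ->]]; apply: subgroup_mul0. Qed.

(** The identity prevents [R] from annihilating anything nonzero. *)
Lemma setT_not_vertex : ~ APOG_vertices [set: R].
Proof.
case=> _ _ [B [iB nB]] []; rewrite subgroup_mul_eq0 => B0; apply: nB;
  (apply/seteqP; split=> [b Bb|_ ->]; last exact: IPO0).
- by rewrite /= -[b]mul1r; apply: B0.
- by rewrite /= -[b]mulr1; apply: B0.
Qed.

Lemma vertex_zero_divisors A x :
  APOG_vertices A -> A x -> zero_divisors R x.
Proof.
case=> _ _ [B [/IPO0 B0 nB AB]] Ax; right.
have [b Bb b0] := exists_nonzero B0 nB; exists b; split=> //.
by case: AB; rewrite subgroup_mul_eq0 => AB; [left | right]; apply: AB.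
Qed.

End Products.

(** * Rings whose graph is complete *)

Section Converse.
Variable R : pzRingType.
Implicit Types (A B I J m : set R) (x y e : R).

Lemma complete_zero_divisors_sqr0 :
  (forall x y, zero_divisors R x -> zero_divisors R y -> x * y = 0) ->
  complete_graph (APOG R).
Proof.
move=> D2 A B vA vB nAB; split=> //; left; apply/subgroup_mul_eq0 => a b Aa Bb.
by apply: D2; [apply: vertex_zero_divisors Aa | apply: vertex_zero_divisors Bb].
Qed.

(** What could annihilate the vertex [m]: not [R], which would force [m = 0],
    and not [m] when [m^2] is a vertex; hence [m^2]. *)
Lemma complete_IPO_chain m :
  IPO R = [set [set 0]; m; subgroup_mul m m; [set: R]] ->
  complete_graph (APOG R).
Proof.
move=> IPOE.
have vE A : APOG_vertices A -> A = m \/ A = subgroup_mul m m.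
  move=> vA; have [] := vA; rewrite {1}IPOE => -[[[|]|]|] // AE nA _.
  - by left.
  - by right.
  - by case: (@setT_not_vertex R); rewrite -AE.
have ann : APOG_vertices m -> APOG_vertices (subgroup_mul m m) ->
    annihilate m (subgroup_mul m m).
  move=> [_ nm [B [iB nB mB]]] [_ nmm _].
  have vB : APOG_vertices B.
    split=> //; exists m; split=> //; first by rewrite IPOE; left; left; right.
    by case: mB; [right | left].
  case: (vE _ vB) => BE; move: mB; rewrite BE // /annihilate.
  by case.
move=> A B vA vB nAB; split=> //.
have [AE|AE] := vE _ vA; have [BE|BE] := vE _ vB; move: vA vB nAB;
  rewrite AE BE // => vA vB _; first exact: ann.
by case: (ann vB vA); [right | left].
Qed.

(** For a central idempotent [e] with [e <> 0], this says that [Re], whose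
    identity is [e], is a division ring, without leaving [R]. *)
Definition corner_division e :=
  forall x, e * x <> 0 -> exists y, y * x = e /\ x * y = e.

Lemma one_sided_corner I e x z : (forall r, e * r = r * e) ->
  corner_division e -> one_sided I -> I x -> e * x <> 0 -> I (e * z).
Proof.
move=> ce de sI Ix /de[y [yx xy]].
case: sI => -[_ _ Im]; first by rewrite ce -yx mulrA; apply: Im.
by rewrite -xy -mulrA; apply: Im.
Qed.

(** If [e x <> 0] for some [x] in [IJ], then [e i] and [e j] are nonzero for
    some [i] in [I] and [j] in [J], so both ideals contain all of [Re]; and
    [Re = Re * e]. *)
Lemma IPO_corner A e x : e * e = e -> (forall r, e * r = r * e) ->
  corner_division e -> IPO R A -> A x -> e * x <> 0 -> forall z, A (e * z).
Proof.
move=> ee ce de [I [J [sI sJ ->]]] IJx ex z.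
have [i [j [Ii Jj eij]]] : exists i j, [/\ I i, J j & e * (i * j) <> 0].
  apply: contrapT => nij; apply: ex; move: x IJx.
  apply: (subgroup_mul_ind (P := fun x => e * x = 0)) => [|x y ex ey|i j Ii Jj].
  - by rewrite mulr0.
  - by rewrite mulrDr ex ey addr0.
  - by apply: contrapT => nz; apply: nij; exists i, j.
have ei : e * i <> 0 by move=> ei; apply: eij; rewrite mulrA ei mul0r.
have ej : e * j <> 0 by move=> ej; apply: eij; rewrite mulrA ce -mulrA ej mulr0.
have -> : e * z = (e * z) * (e * 1) by rewrite mulr1 -mulrA -ce mulrA ee.
by apply: mem_subgroup_mul;
  [apply: one_sided_corner Ii ei | apply: one_sided_corner Jj ej].
Qed.

(** By [IPO_corner] a vertex contains each of [Re] and [R(1 - e)] that it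
    meets nontrivially. It cannot contain both, since [R] is not a vertex, so
    the only vertices are these two orthogonal ideals. *)
Lemma complete_two_corners e : e * e = e -> (forall r, e * r = r * e) ->
  corner_division e -> corner_division (1 - e) -> complete_graph (APOG R).
Proof.
move=> ee ce de df; set f := 1 - e in df.
have ff : f * f = f.
  by rewrite /f mulrBl mul1r mulrBr mulr1 ee subrr subr0.
have cf r : f * r = r * f by rewrite /f mulrBl mulrBr mul1r mulr1 ce.
have ef : e * f = 0 by rewrite /f mulrBr mulr1 ee subrr.
have fe : f * e = 0 by rewrite cf.
have efE r : r = e * r + f * r by rewrite -mulrDl /f addrC subrK mul1r.
pose eR : set R := [set x | e * x = x]; pose fR : set R := [set x | f * x = x].
have vE A : APOG_vertices A -> A = eR \/ A = fR.
  move=> vA; have [iA nA _] := vA.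
  have [x Ax x0] := exists_nonzero (IPO0 iA) nA.
  have only g h : g * g = g -> h * h = h -> h * g = 0 ->
      (forall r, g * r = r * g) -> (forall r, h * r = r * h) ->
      corner_division g -> corner_division h ->
      (forall r, r = g * r + h * r) -> g * x <> 0 -> A = [set x | g * x = x].
    move=> gg hh hg cg ch dg dh ghE gx.
    apply/seteqP; split=> y.
      move=> Ay; apply: contrapT => gy.
      have hy : h * y <> 0.
        by move=> hy; apply: gy; rewrite /= [RHS]ghE hy addr0.
      apply: (@setT_not_vertex R); suff <- : A = setT by [].
      apply/seteqP; split=> // z _; rewrite (ghE z).
      have Ag := IPO_corner gg cg dg iA Ax gx z.
      have Ah := IPO_corner hh ch dh iA Ay hy z.
      have [I [J [sI sJ AE]]] := iA; move: Ag Ah; rewrite AE.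
      exact: subgroup_mulD.
    by move=> /= <-; apply: (IPO_corner gg cg dg iA Ax gx).
  have [ex|ex] := pselect (e * x = 0); last by left; apply: (only e f).
  right; apply: (only f e) => // [r|]; first by rewrite addrC -efE.
  by move=> fx; apply: x0; rewrite (efE x) ex fx addr0.
have eRfR a b : eR a -> fR b -> a * b = 0.
  by rewrite /eR /fR /= => <- <-; rewrite ce -mulrA (mulrA e) ef mul0r mulr0.
have fReR a b : fR a -> eR b -> a * b = 0.
  by rewrite /eR /fR /= => <- <-; rewrite cf -mulrA (mulrA f) fe mul0r mulr0.
move=> A B vA vB nAB; split=> //; left; apply/subgroup_mul_eq0.
by have [AE|AE] := vE _ vA; have [BE|BE] := vE _ vB; move: nAB; rewrite AE BE.
Qed.

Lemma complete_division_product (D1 D2 : pzRingType)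
    (f : {rmorphism R -> (D1 * D2)%type}) :
  is_division_ring D1 -> is_division_ring D2 -> bijective f ->
  complete_graph (APOG R).
Proof.
move=> [_ dD1] [_ dD2] bf; have [g fK gK] := bf; have fI := bij_inj bf.
apply: (@complete_two_corners (g (1, 0))).
- by apply: fI; rewrite rmorphM gK; congr pair; rewrite /= ?mulr1 ?mulr0.
- move=> r; apply: fI; rewrite !rmorphM gK; case: (f r) => a b.
  by congr pair; rewrite /= ?mulr1 ?mul1r ?mulr0 ?mul0r.
- move=> x ex; have x1 : (f x).1 <> 0.
    move=> x1; apply: ex; apply: fI; rewrite rmorphM gK rmorph0.
    by congr pair; rewrite /= ?x1 ?mulr0 ?mul0r.
  have [y [xy yx]] := dD1 _ x1; exists (g (y, 0)).
  by split; apply: fI; rewrite rmorphM !gK; congr pair;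
    rewrite /= ?mulr0 ?mul0r.
- move=> x ex; have x2 : (f x).2 <> 0.
    move=> x2; apply: ex; apply: fI.
    rewrite rmorphM rmorphB gK !rmorph1 rmorph0.
    by congr pair; rewrite /= ?x2 ?subrr ?mulr0 ?mul0r.
  have [y [xy yx]] := dD2 _ x2; exists (g (0, y)).
  split; apply: fI; rewrite rmorphM rmorphB rmorph1 !gK; congr pair;
    by rewrite /= ?mulr0 ?mul0r ?subrr ?subr0.
Qed.

End Converse.

(** * Corner rings and the Peirce decomposition *)

Section Corner.
Variables (R : pzRingType) (e : R).

Definition corner_pred : {pred R} := [pred x | e * x * e == x].

Lemma corner_zmod_closed : zmod_closed corner_pred.
Proof.
split=> [|x y]; rewrite !inE ?mulr0 ?mul0r // => /eqP xE /eqP yE.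
by rewrite mulrBr mulrBl xE yE.
Qed.

HB.instance Definition _ :=
  GRing.isZmodClosed.Build R corner_pred corner_zmod_closed.

(** The corner ring [eRe]. The idempotence of [e] is a parameter because the
    ring structure, whose identity is [e], depends on it. *)
Definition corner of e * e = e := {x : R | corner_pred x}.

Variable ee : e * e = e.

HB.instance Definition _ := [isSub of corner ee for sval].
HB.instance Definition _ := [Choice of corner ee by <:].
HB.instance Definition _ := [SubChoice_isSubZmodule of corner ee by <:].

Implicit Types x y z : corner ee.

Lemma corner_mull x : e * val x = val x.
Proof. by case: x => x /= /eqP <-; rewrite !mulrA ee. Qed.

Lemma corner_mulr x : val x * e = val x.
Proof. by case: x => x /= /eqP <-; rewrite -!mulrA ee. Qed.

Lemma corner_compress_subproof (r : R) : corner_pred (e * r * e).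
Proof. by apply/eqP; rewrite !mulrA ee -!mulrA ee. Qed.

Definition corner_compress (r : R) : corner ee :=
  exist _ (e * r * e) (corner_compress_subproof r).

Lemma val_corner_compress r : val (corner_compress r) = e * r * e.
Proof. by []. Qed.

Definition corner_one := corner_compress 1.
Definition corner_mul x y := corner_compress (val x * val y).

Lemma val_corner_one : val corner_one = e.
Proof. by rewrite val_corner_compress mulr1 ee. Qed.

Lemma val_corner_mul x y : val (corner_mul x y) = val x * val y.
Proof.
by rewrite val_corner_compress mulrA corner_mull -mulrA corner_mulr.
Qed.

Lemma val_cornerD x y : val (x + y) = val x + val y.
Proof. by []. Qed.

Let cornerE :=
  (val_corner_mul, val_cornerD, val_corner_one, corner_mull, corner_mulr).

Lemma corner_mulA : associative corner_mul.
Proof. by move=> x y z; apply: val_inj; rewrite !cornerE mulrA. Qed.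
Lemma corner_mul1r : left_id corner_one corner_mul.
Proof. by move=> x; apply: val_inj; rewrite !cornerE. Qed.
Lemma corner_mulr1 : right_id corner_one corner_mul.
Proof. by move=> x; apply: val_inj; rewrite !cornerE. Qed.
Lemma corner_mulDl : left_distributive corner_mul +%R.
Proof. by move=> x y z; apply: val_inj; rewrite !cornerE mulrDl. Qed.
Lemma corner_mulDr : right_distributive corner_mul +%R.
Proof. by move=> x y z; apply: val_inj; rewrite !cornerE mulrDr. Qed.

HB.instance Definition _ := GRing.Zmodule_isPzRing.Build (corner ee)
  corner_mulA corner_mul1r corner_mulr1 corner_mulDl corner_mulDr.

Lemma val_corner1 : val (1 : corner ee) = e.
Proof. exact: val_corner_one. Qed.
Lemma val_cornerM x y : val (x * y) = val x * val y.
Proof. exact: val_corner_mul. Qed.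

End Corner.

(** A left inverse [y] of [x] has itself a left inverse, which has to be [x]. *)
Lemma left_inverses_division (D : pzRingType) : (1 : D) <> 0 ->
  (forall x : D, x <> 0 -> exists y, y * x = 1) -> is_division_ring D.
Proof.
move=> n10 linv; split=> // x /linv[y yx]; exists y; split=> //.
have [y0|z zy] := linv y; first by apply: n10; rewrite -yx y0 mul0r.
by rewrite -[x]mul1r -zy -(mulrA z) yx mulr1.
Qed.

Lemma corner_division_ring (R : pzRingType) (e : R) (ee : e * e = e) : e <> 0 ->
  (forall a, a <> 0 -> e * a * e = a -> exists r, r * a = e) ->
  is_division_ring (corner ee).
Proof.
move=> e0 linv; apply: left_inverses_division => [/(congr1 val)|x x0].
  by rewrite val_corner1.
have [|r rx] := linv (val x) _ (eqP (valP x)).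
  by move=> vx0; apply: x0; apply: val_inj.
exists (corner_compress ee r); apply: val_inj.
rewrite val_corner1 val_cornerM val_corner_compress -mulrA corner_mull.
by rewrite -mulrA rx ee.
Qed.

Lemma peirce_iso (R : pzRingType) (e f : R) (ee : e * e = e) (ff : f * f = f) :
    (forall r, e * r = r * e) -> e + f = 1 ->
  exists h : {rmorphism R -> (corner ee * corner ff)%type}, bijective h.
Proof.
move=> ce ef1.
have fE : f = 1 - e by rewrite -ef1 addrC addKr.
have cf r : f * r = r * f by rewrite fE mulrBl mulrBr mul1r mulr1 ce.
have ef : e * f = 0 by rewrite fE mulrBr mulr1 ee subrr.
pose h r := (corner_compress ee r, corner_compress ff r).
have compM g (gg : g * g = g) : (forall r, g * r = r * g) ->
    forall r s, corner_compress gg (r * s) =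
                corner_compress gg r * corner_compress gg s.
  move=> cg r s; apply: val_inj; rewrite val_cornerM !val_corner_compress.
  by rewrite !mulrA -(mulrA (g * r) g g) gg -(cg (g * r)) mulrA gg.
have comp1 g (gg : g * g = g) : corner_compress gg 1 = 1 by [].
have compB g (gg : g * g = g) r s : corner_compress gg (r - s) =
                corner_compress gg r - corner_compress gg s.
  by apply: val_inj; rewrite /= mulrBr mulrBl.
have hB : zmod_morphism h by move=> r s; rewrite /h !compB.
have hM : monoid_morphism h by split=> [|r s]; rewrite /h ?comp1 // !compM.
pose hz := GRing.isZmodMorphism.Build _ _ h hB.
pose hm := GRing.isMonoidMorphism.Build _ _ h hM.
pose H : {rmorphism R -> (corner ee * corner ff)%type} := HB.pack h hz hm.
exists H; exists (fun p => val p.1 + val p.2) => [r|[x y]].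
  rewrite /= -!ce -!cf !mulrA ee ff -mulrDl ef1; exact: mul1r.
have fx : f * val x = 0 by rewrite cf -(corner_mull x) ce -mulrA ef mulr0.
have ey : e * val y = 0 by rewrite -(corner_mull y) mulrA ef mul0r.
congr pair; apply: val_inj; rewrite val_corner_compress mulrDr.
  by rewrite ey addr0 corner_mull corner_mulr.
by rewrite fx add0r corner_mull corner_mulr.
Qed.

(** * Principal one-sided ideals and nilpotence *)

Section PrincipalIdeals.
Variable R : pzRingType.
Implicit Types (a b e r u x y : R) (I J : set R).

Definition lideal x : set R := [set y | exists r, y = r * x].
Definition rideal x : set R := [set y | exists r, y = x * r].

Lemma left_ideal_lideal x : left_ideal (lideal x).
Proof.
split=> [|_ _ [r ->] [s ->]|r _ [s ->]]; first by exists 0; rewrite mul0r.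
  by exists (r - s); rewrite mulrBl.
by exists (r * s); rewrite mulrA.
Qed.

Lemma right_ideal_rideal x : right_ideal (rideal x).
Proof.
split=> [|_ _ [r ->] [s ->]|r _ [s ->]]; first by exists 0; rewrite mulr0.
  by exists (r - s); rewrite mulrBr.
by exists (s * r); rewrite mulrA.
Qed.

Lemma mem_lideal x : lideal x x. Proof. by exists 1; rewrite mul1r. Qed.
Lemma mem_rideal x : rideal x x. Proof. by exists 1; rewrite mulr1. Qed.

Definition left_zero_divisor x := exists2 b, b <> 0 & x * b = 0.
Definition right_zero_divisor x := exists2 b, b <> 0 & b * x = 0.

(** The trace of completeness on principal left ideals. Stated for any ring,
    so that it can be used in the converse ring as well. *)
Definition left_left_adjacent := forall x y,
  left_zero_divisor x -> left_zero_divisor y ->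
  [\/ lideal x = lideal y, forall r, x * r * y = 0 | forall r, y * r * x = 0].

Definition nontrivial_idempotent e := [/\ e * e = e, e <> 0 & e <> 1].

(** If [x^3 <> 0], the products of [Rx] and [Rx^2] in both orders are nonzero,
    so [Rx = Rx^2] and [x = t x^2]. The element [e = t x] fixes [x] on the left,
    and [g = e - e^2] is a left multiple of [x] that kills [x]. Hence
    [Rg = Rx] would give [x^2 = 0], and [Rg Rx = 0] or [Rx Rg = 0] gives
    [g e = 0] or [e g = 0]. Either way [e^3 = e^2], so [e^2] is idempotent; it
    is not [0] because it fixes [x], and not [1] because it kills [b]. *)
Lemma left_zero_divisor_nilpotent x :
    left_left_adjacent -> (forall e, ~ nontrivial_idempotent e) ->
  left_zero_divisor x -> x * x * x = 0.
Proof.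
move=> ll nidem lx; have [b b0 xb] := lx.
have lm r : left_zero_divisor (r * x).
  by exists b; rewrite // -mulrA xb mulr0.
apply: contrapT => x3.
have x2 : x * x <> 0 by move=> x2; apply: x3; rewrite x2 mul0r.
have [t xE] : exists t, x = t * (x * x).
  have [xx|xx|xx] := ll _ _ lx (lm x).
  - by have := mem_lideal x; rewrite xx.
  - by case: x3; rewrite -(xx 1) mulr1 mulrA.
  - by case: x3; rewrite -(xx 1) mulr1.
pose e := t * x; have ex : e * x = x by rewrite /e -mulrA -xE.
have ge : (e - e * e) * e = 0 \/ e * (e - e * e) = 0.
  have gE : e - e * e = (t - e * t) * x by rewrite mulrBl -(mulrA e t x).
  have gx : (e - e * e) * x = 0 by rewrite mulrBl -(mulrA e e x) !ex subrr.
  have [||gx'|gx'] := ll (e - e * e) x _ lx; first by rewrite gE; apply: lm.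
  - move=> xg; have [w xw] : lideal (e - e * e) x.
      by rewrite xg; apply: mem_lideal.
    by case: x2; rewrite {1}xw -mulrA gx mulr0.
  - by left; have := gx' t; rewrite -mulrA.
  - by right; rewrite -[RHS](mulr0 t) -(gx' 1) mulr1 mulrA.
have e3 : e * e * e = e * e.
  apply/esym/eqP; rewrite -subr_eq0 -mulrBl; apply/eqP.
  by case: ge => //; rewrite mulrBr mulrBl mulrA.
apply: (nidem (e * e)); split; first by rewrite mulrA e3.
- move=> ee0; case: x2; have := ex.
  by rewrite -{1}ex mulrA ee0 mul0r => <-; rewrite mulr0.
- by move=> ee1; apply: b0; rewrite -[b]mul1r -ee1 /e -!mulrA xb !mulr0.
Qed.

(** Peel off powers of [x]: an ideal without left invertible elements lies in
    [Rx]; if it does not contain [x], then all cofactors of [x] in it are again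
    in [Rx], so it lies in [Rx^2]; the same step once more ends in
    [Rx^3 = 0]. *)
Lemma left_ideal_chain x I : x * x * x = 0 ->
    (forall u, lideal x u \/ exists w, w * u = 1) -> left_ideal I ->
  [\/ I = [set 0], I = lideal x, I = lideal (x * x) | I = setT].
Proof.
move=> x3 unit_ [I0 _ Im].
have [[u Iu [w wu]]|nT] := pselect (exists2 u, I u & exists w, w * u = 1).
  constructor 4; apply/seteqP; split=> // r _.
  by rewrite -[r]mulr1 -wu mulrA; apply: (Im).
have Ix r : I r -> lideal x r.
  by move=> Ir; case: (unit_ r) => // wr; case: nT; exists r.
have [nx|nx] := pselect (I x).
  constructor 2; apply/seteqP; split=> // _ [r ->]; exact: Im.
have Ixx r : I r -> lideal (x * x) r.
  move=> Ir; have [s rE] := Ix _ Ir; have [[t sE]|[w ws]] := unit_ s.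
    by exists t; rewrite rE sE mulrA.
  by case: nx; rewrite -[x]mul1r -ws -mulrA -rE; apply: Im.
have [nxx|nxx] := pselect (I (x * x)).
  constructor 3; apply/seteqP; split=> // _ [r ->]; exact: Im.
constructor 1; apply/seteqP; split=> [r Ir|_ -> //].
have [s rE] := Ixx _ Ir; have [[t sE]|[w ws]] := unit_ s.
  by rewrite /= rE sE -mulrA [x * (x * x)]mulrA x3 mulr0.
by case: nxx; rewrite -[x * x]mul1r -ws -mulrA -rE; apply: Im.
Qed.

End PrincipalIdeals.

(** [left_zero_divisor_nilpotent] in the converse ring. *)
Lemma right_zero_divisor_nilpotent (R : pzRingType) (x : R) :
    (forall x y : R, right_zero_divisor x -> right_zero_divisor y ->
       [\/ rideal x = rideal y, forall r, x * r * y = 0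
         | forall r, y * r * x = 0]) ->
    (forall e : R, ~ nontrivial_idempotent e) ->
  right_zero_divisor x -> x * x * x = 0.
Proof.
move=> rr nidem rx; rewrite -mulrA.
apply: (@left_zero_divisor_nilpotent R^c x) => //.
move=> a b ra rb; case: (rr a b ra rb) => h;
  [constructor 1 | constructor 3 | constructor 2] => // r;
  by rewrite -(h r) -[RHS]mulrA.
Qed.

(** [left_ideal_chain] in the converse ring. *)
Lemma right_ideal_chain (R : pzRingType) (x : R) I : x * x * x = 0 ->
    (forall u, rideal x u \/ exists w, u * w = 1) -> right_ideal I ->
  [\/ I = [set 0], I = rideal x, I = rideal (x * x) | I = setT].
Proof.
move=> x3; apply: (@left_ideal_chain R^c x).
by rewrite -x3 -[RHS]mulrA.
Qed.

Lemma geometric_inverse (R : pzRingType) (n : R) :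
  n * n * n = 0 -> (1 + n + n * n) * (1 - n) = 1.
Proof.
move=> n3; rewrite mulrBr mulr1 !mulrDl mul1r n3 addr0.
by rewrite -(addrA 1 n) addrK.
Qed.

(** * Consequences of completeness *)

Section Complete.
Variable R : pzRingType.
Hypothesis complete : complete_graph (APOG R).
Implicit Types (a b c e r u v x y : R) (I J : set R).

(** Being annihilated by a one-sided ideal makes a nonzero one-sided ideal a
    vertex. Leaving [0] in lets zero elements through in the trichotomies
    below. *)
Definition annihilated I := exists K,
  [/\ one_sided K, K <> [set 0] &
      (forall a b, I a -> K b -> a * b = 0) \/
      (forall a b, K a -> I b -> a * b = 0)].

Lemma one_sided_vertex I :
  one_sided I -> I <> [set 0] -> annihilated I -> APOG_vertices I.
Proof.
move=> sI nI [K [sK nK IK]]; split=> //; first exact: IPO_one_sided.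
exists K; split=> //; first exact: IPO_one_sided.
by case: IK => IK; [left | right]; apply/subgroup_mul_eq0.
Qed.

Lemma one_sided_adjacent I J :
    one_sided I -> one_sided J -> annihilated I -> annihilated J ->
  [\/ I = J, forall a b, I a -> J b -> a * b = 0
    | forall a b, J a -> I b -> a * b = 0].
Proof.
move=> sI sJ aI aJ.
have [->|nIJ] := pselect (I = J); first by constructor 1.
have [I0|nI] := pselect (I = [set 0]).
  by constructor 2 => a b; rewrite I0 => ->; rewrite mul0r.
have [J0|nJ] := pselect (J = [set 0]).
  by constructor 2 => a b _; rewrite J0 => ->; rewrite mulr0.
have [||_ _ _ IJ] := complete _ _ nIJ; try exact: one_sided_vertex.
by case: IJ; rewrite subgroup_mul_eq0; [constructor 2 | constructor 3].
Qed.

(** From [x b = 0] one gets [Rx * bR = 0]; the product [xR * Rb] could be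
    nonzero, so the sides matter. *)
Lemma annihilated_lideal x : left_zero_divisor x -> annihilated (lideal x).
Proof.
case=> b b0 xb; exists (rideal b); split.
- by right; apply: right_ideal_rideal.
- exact: nonzero_mem (mem_rideal b) b0.
- by left=> _ _ [r ->] [s ->]; rewrite -mulrA (mulrA x) xb mul0r mulr0.
Qed.

Lemma annihilated_rideal x : right_zero_divisor x -> annihilated (rideal x).
Proof.
case=> b b0 bx; exists (lideal b); split.
- by left; apply: left_ideal_lideal.
- exact: nonzero_mem (mem_lideal b) b0.
- by right=> _ _ [r ->] [s ->]; rewrite -mulrA (mulrA b) bx mul0r mulr0.
Qed.

Lemma complete_left_left : left_left_adjacent R.
Proof.
move=> x y /annihilated_lideal ax /annihilated_lideal ay.
have sl (z : R) : one_sided (lideal z) by left; apply: left_ideal_lideal.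
case: (one_sided_adjacent (sl x) (sl y) ax ay) => h.
- by constructor 1.
- constructor 2 => r; rewrite -mulrA.
  by apply: h; [apply: mem_lideal | exists r].
- constructor 3 => r; rewrite -mulrA.
  by apply: h; [apply: mem_lideal | exists r].
Qed.

Lemma complete_right_right x y :
    right_zero_divisor x -> right_zero_divisor y ->
  [\/ rideal x = rideal y, forall r, x * r * y = 0 | forall r, y * r * x = 0].
Proof.
move=> /annihilated_rideal ax /annihilated_rideal ay.
have sr (z : R) : one_sided (rideal z) by right; apply: right_ideal_rideal.
case: (one_sided_adjacent (sr x) (sr y) ax ay) => h.
- by constructor 1.
- by constructor 2 => r; apply: h; [exists r | apply: mem_rideal].
- by constructor 3 => r; apply: h; [exists r | apply: mem_rideal].
Qed.

Lemma complete_left_right x y :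
    left_zero_divisor x -> right_zero_divisor y ->
  [\/ lideal x = rideal y, x * y = 0 | forall r, y * r * x = 0].
Proof.
move=> /annihilated_lideal ax /annihilated_rideal ay.
have sx : one_sided (lideal x) by left; apply: left_ideal_lideal.
have sy : one_sided (rideal y) by right; apply: right_ideal_rideal.
case: (one_sided_adjacent sx sy ax ay) => h.
- by constructor 1.
- by constructor 2; apply: h; [apply: mem_lideal | apply: mem_rideal].
- by constructor 3 => r; apply: h; [exists r | apply: mem_lideal].
Qed.

(** Both [Re * eR] and [eR * Re] contain [e], so they are nonzero and
    [Re = eR]. *)
Lemma idempotent_central e : nontrivial_idempotent e -> forall r, e * r = r * e.
Proof.
case=> ee e0 e1.
have f0 : 1 - e <> 0 by move=> /eqP; rewrite subr_eq0 => /eqP /esym.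
have le : left_zero_divisor e.
  by exists (1 - e); rewrite // mulrBr mulr1 ee subrr.
have re : right_zero_divisor e.
  by exists (1 - e); rewrite // mulrBl mul1r ee subrr.
have [eq_e|ee0|ee0] := complete_left_right le re => r.
- have [s reE] : rideal e (r * e) by rewrite -eq_e; exists r.
  have [t erE] : lideal e (e * r) by rewrite eq_e; exists r.
  transitivity (e * r * e); first by rewrite {2}erE -mulrA ee.
  by rewrite -mulrA reE mulrA ee.
- by case: e0; rewrite -ee.
- by case: e0; rewrite -ee -{1}ee -(ee0 e).
Qed.

(** For [a = a e = e a] nonzero, [Re * Ra] and [Ra * Re] contain [a], so
    [Re = Ra] contains [e]. *)
Lemma idempotent_corner_division e (ee : e * e = e) :
  nontrivial_idempotent e -> is_division_ring (corner ee).
Proof.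
move=> ne; have [_ e0 e1] := ne; apply: corner_division_ring => // a a0 aE.
have f0 : 1 - e <> 0 by move=> /eqP; rewrite subr_eq0 => /eqP /esym.
have le : left_zero_divisor e.
  by exists (1 - e); rewrite // mulrBr mulr1 ee subrr.
have ae : a * e = a by rewrite -aE -mulrA ee.
have ea : e * a = a by rewrite -aE !mulrA ee.
have la : left_zero_divisor a.
  by exists (1 - e); rewrite // mulrBr mulr1 ae subrr.
have [eq_ea|ea0|ae0] := complete_left_left le la.
- by have := mem_lideal e; rewrite eq_ea => -[r re]; exists r.
- by case: a0; rewrite -ea -[e]mulr1 ea0.
- by case: a0; rewrite -ae -[a]mulr1 ae0.
Qed.

Lemma idempotent_division_product e : nontrivial_idempotent e ->
  exists (D1 D2 : pzRingType) (f : {rmorphism R -> (D1 * D2)%type}),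
    [/\ is_division_ring D1, is_division_ring D2 & bijective f].
Proof.
move=> ne; have [ee e0 e1] := ne.
have ff : (1 - e) * (1 - e) = 1 - e.
  by rewrite mulrBl mul1r mulrBr mulr1 ee subrr subr0.
have [||h bh] := peirce_iso ee ff; first exact: idempotent_central.
  by rewrite addrC subrK.
exists (corner ee), (corner ff), h; split=> //.
  exact: idempotent_corner_division.
apply: idempotent_corner_division; split=> //.
- by move=> /eqP; rewrite subr_eq0 => /eqP /esym.
- by move=> /eqP; rewrite -subr_eq0 addrAC subrr add0r oppr_eq0 => /eqP.
Qed.

(** * Completeness without nontrivial idempotents *)

Section Nil.
Hypothesis nidem : forall e, ~ nontrivial_idempotent e.
Hypothesis R1 : (1 : R) <> 0.
Let D := zero_divisors R.

Lemma zero_divisor_cube0 x : D x -> x * x * x = 0.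
Proof.
have N y : right_zero_divisor y -> y * y * y = 0.
  exact: right_zero_divisor_nilpotent complete_right_right nidem.
case=> [->|[b [b0 []]] xb]; first by rewrite mulr0.
- apply: left_zero_divisor_nilpotent nidem _; first exact: complete_left_left.
  by exists b.
- by apply: N; exists b.
Qed.

(** The last nonzero power of [x]; it annihilates [x] on both sides, so the
    two notions of zero-divisor agree. *)
Lemma zero_divisor_killer x :
  D x -> exists b, [/\ b <> 0, x * b = 0 & b * x = 0].
Proof.
move=> /zero_divisor_cube0 x3.
have [x0|x0] := pselect (x = 0).
  by exists 1; rewrite x0 mulr0 mul0r.
have [xx0|xx0] := pselect (x * x = 0); first by exists x.
by exists (x * x); rewrite mulrA.
Qed.

Lemma zero_divisor_left x : D x -> left_zero_divisor x.
Proof. by move=> /zero_divisor_killer[b [b0 xb bx]]; exists b. Qed.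

Lemma zero_divisor_right x : D x -> right_zero_divisor x.
Proof. by move=> /zero_divisor_killer[b [b0 xb bx]]; exists b. Qed.

Lemma zero_divisorMl r x : D x -> D (r * x).
Proof.
move=> /zero_divisor_left[b b0 xb]; right; exists b; split=> //; left.
by rewrite -mulrA xb mulr0.
Qed.

Lemma zero_divisorMr r x : D x -> D (x * r).
Proof.
move=> /zero_divisor_right[b b0 bx]; right; exists b; split=> //; right.
by rewrite mulrA bx mul0r.
Qed.

Lemma regularl u x : ~ D u -> u * x = 0 -> x = 0.
Proof.
move=> nDu ux; apply: contrapT => x0; apply: nDu; right; exists x.
by split=> //; left.
Qed.

Lemma zero_divisor_mul0 x y : x * y = 0 -> y <> 0 -> D x.
Proof. by move=> xy y0; right; exists y; split=> //; left. Qed.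

(** Let [b] annihilate [x] on both sides. If [b] annihilates [y] on some
    side, it annihilates [x + y] there. Otherwise [Ry * bR] and [bR * Ry] are
    nonzero, so [Ry = bR], whence [x y = 0], and the last nonzero power of [y]
    annihilates [x + y] on the right. *)
Lemma zero_divisorD x y : D x -> D y -> D (x + y).
Proof.
move=> Dx Dy; have [b [b0 xb bx]] := zero_divisor_killer Dx.
have [x0|x0] := pselect (x = 0); first by rewrite x0 add0r.
have rb : right_zero_divisor b by exists x.
have [yb|yb] := pselect (y * b = 0).
  by apply: (zero_divisor_mul0 _ b0); rewrite mulrDl xb yb addr0.
have [by0|by0] := pselect (b * y = 0).
  by right; exists b; split=> //; right; rewrite mulrDr bx by0 addr0.
have [eq_yb|//|bRy] :=
    complete_left_right (zero_divisor_left Dy) rb; last first.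
  by case: by0; rewrite -[b]mulr1.
have [r yE] : rideal b y by rewrite -eq_yb; apply: mem_lideal.
have xy : x * y = 0 by rewrite yE mulrA xb mul0r.
have [y0|y0] := pselect (y = 0); first by rewrite y0 addr0.
have [yy|yy] := pselect (y * y = 0).
  by apply: (zero_divisor_mul0 _ y0); rewrite mulrDl xy yy addr0.
apply: (zero_divisor_mul0 _ yy).
by rewrite mulrDl !mulrA xy mul0r zero_divisor_cube0 // addr0.
Qed.

Lemma zero_divisorN x : D x -> D (- x).
Proof. by rewrite -mulN1r; apply: zero_divisorMl. Qed.

Lemma left_ideal_zero_divisors : left_ideal D.
Proof.
split=> [|x y Dx /zero_divisorN|r x]; [by left | exact: zero_divisorD |].
exact: zero_divisorMl.
Qed.

(** If all squares vanished on [D], then [y x = - x y <> 0], so that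
    [Rx = yR]; writing [x = y r] gives [y x = y^2 r = 0]. *)
Lemma zero_divisor_sqr_neq0 x y :
  D x -> D y -> x * y <> 0 -> exists2 z, D z & z * z <> 0.
Proof.
move=> Dx Dy xy; apply: contrapT => nz.
have sq z : D z -> z * z = 0.
  by move=> Dz; apply: contrapT => zz; apply: nz; exists z.
have yx : y * x = - (x * y).
  apply/eqP; rewrite -addr_eq0; apply/eqP.
  have := sq _ (zero_divisorD Dx Dy).
  by rewrite mulrDl !mulrDr !sq // addr0 add0r addrC.
have yx0 : y * x <> 0 by rewrite yx => /eqP; rewrite oppr_eq0 => /eqP.
have [eq_xy|//|yx1] :=
    complete_left_right (zero_divisor_left Dx) (zero_divisor_right Dy).
  have [r xE] : rideal y x by rewrite -eq_xy; apply: mem_lideal.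
  by apply: yx0; rewrite xE mulrA sq // mul0r.
by apply: yx0; rewrite -[y]mulr1.
Qed.

Section Generator.
Variable x : R.
Hypotheses (Dx : D x) (xx : x * x <> 0).

Let x3 : x * x * x = 0 := zero_divisor_cube0 Dx.
Let Dxx : D (x * x) := zero_divisorMl x Dx.

Lemma lideal_eq_rideal : lideal x = rideal x.
Proof.
have [//|//|x1] :=
    complete_left_right (zero_divisor_left Dx) (zero_divisor_right Dx).
by case: xx; rewrite -{1}[x]mulr1.
Qed.

(** If [y x^2 <> 0] then [Ry * xR <> 0], and [Ry = xR = Rx] is excluded by
    [x^3 = 0]; so [xR * Ry = 0]. *)
Lemma zero_divisor_mulxx y : D y -> y * (x * x) = 0 \/ x * x * y = 0.
Proof.
move=> Dy; have [yx|yx] := pselect (y * (x * x) = 0); [by left | right].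
have [eq_yx|yx0|xRy] :=
    complete_left_right (zero_divisor_left Dy) (zero_divisor_right Dx).
- case: yx; have [s ->] : lideal x y.
    by rewrite lideal_eq_rideal -eq_yx; apply: mem_lideal.
  by rewrite -!mulrA (mulrA x) x3 mulr0.
- by case: yx; rewrite mulrA yx0 mul0r.
- exact: xRy.
Qed.

(** By [zero_divisor_mulxx], the group [D] is a union of two subgroups, so it
    equals one of them. *)
Lemma mulxx_annihilates :
  (forall y, D y -> y * (x * x) = 0) \/ (forall y, D y -> x * x * y = 0).
Proof.
apply: contrapT => /not_orP[/existsNP[y /not_implyP[Dy yx]]].
move=> /existsNP[z /not_implyP[Dz xz]].
have [//|xy] := zero_divisor_mulxx Dy.
have [zx|//] := zero_divisor_mulxx Dz.
have [yz|yz] := zero_divisor_mulxx (zero_divisorD Dy Dz).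
  by apply: yx; rewrite -yz mulrDl zx addr0.
by apply: xz; rewrite -yz mulrDr xy add0r.
Qed.

Lemma annihilated_zero_divisors : annihilated D.
Proof.
case: mulxx_annihilates => h.
  exists (rideal (x * x)); split; first by right; apply: right_ideal_rideal.
    exact: nonzero_mem (mem_rideal _) xx.
  by left=> a _ Da [r ->]; rewrite mulrA h // mul0r.
exists (lideal (x * x)); split; first by left; apply: left_ideal_lideal.
  exact: nonzero_mem (mem_lideal _) xx.
by right=> _ b [r ->] Db; rewrite -mulrA h // mulr0.
Qed.

(** As [D] is annihilated, completeness compares it with [Rx], and both
    products contain [x^2 <> 0]. *)
Lemma zero_divisors_lideal : D = lideal x.
Proof.
have [||||//|h|h] := @one_sided_adjacent D (lideal x).
- by left; apply: left_ideal_zero_divisors.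
- by left; apply: left_ideal_lideal.
- exact: annihilated_zero_divisors.
- exact: annihilated_lideal (zero_divisor_left Dx).
- by case: xx; apply: h => //; apply: mem_lideal.
- by case: xx; apply: h => //; apply: mem_lideal.
Qed.

Lemma zero_divisors_rideal : D = rideal x.
Proof. by rewrite zero_divisors_lideal lideal_eq_rideal. Qed.

(** Compare [Rux] with [Rx]. If they are equal, [x = s u x], so [1 - s u] is a
    zero-divisor, thus nilpotent, and [s u] is invertible. The product
    [Rux * Rx] contains [u x^2 <> 0]. If [Rx * Rux = 0], write [u x = x v];
    then [x^2 v = x u x = 0], so [v] is nilpotent and [u^3 x = x v^3 = 0],
    which is absurd as [u] is not a zero-divisor. *)
Lemma left_invertible u : ~ D u -> exists w, w * u = 1.
Proof.
move=> nDu.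
have Dux : D (u * x) by apply: zero_divisorMl.
have [eq_ux|ux|xux] :=
    complete_left_left (zero_divisor_left Dux) (zero_divisor_left Dx).
- have [s xE] : lideal (u * x) x by rewrite eq_ux; apply: mem_lideal.
  pose n := 1 - s * u.
  have Dn : D n.
    apply: (@zero_divisor_mul0 n x); last first.
      by move=> x0; apply: xx; rewrite x0 mulr0.
    by rewrite mulrBl mul1r -mulrA -xE subrr.
  have n3 := zero_divisor_cube0 Dn.
  exists ((1 + n + n * n) * s); rewrite -mulrA.
  rewrite -[RHS](geometric_inverse n3); congr (_ * _).
  by rewrite /n opprB addrCA subrr addr0.
- by case: xx; apply: (regularl nDu); rewrite mulrA -[u * x]mulr1.
have [v uxE] : rideal x (u * x) by rewrite -zero_divisors_rideal.
have Dv : D v.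
  right; exists (x * x); split=> //; right.
  by rewrite -mulrA -uxE -[X in X * _]mulr1 xux.
case: xx; suff -> : x = 0 by rewrite mulr0.
do 3!apply: (regularl nDu).
have uxM z : u * (x * z) = x * (v * z) by rewrite mulrA uxE -mulrA.
by rewrite uxE !uxM (mulrA v) zero_divisor_cube0 // mulr0.
Qed.

(** A left inverse of [u] is outside [D] too, since [1] is, so it is
    invertible on the left as well. *)
Lemma right_invertible u : ~ D u -> exists w, u * w = 1.
Proof.
move=> nDu; have [w wu] := left_invertible nDu; exists w.
have nDw : ~ D w.
  move=> /(zero_divisorMr u); rewrite wu => D1; apply: R1.
  by rewrite -(zero_divisor_cube0 D1) !mulr1.
have [z zw] := left_invertible nDw.
by rewrite -[u]mul1r -zw -(mulrA z) wu mulr1.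
Qed.

Lemma left_ideal_cases I : left_ideal I ->
  [\/ I = [set 0], I = D, I = lideal (x * x) | I = setT].
Proof.
rewrite zero_divisors_lideal; apply: left_ideal_chain => // u.
rewrite -zero_divisors_lideal.
by have [|/left_invertible] := pselect (D u); [left | right].
Qed.

Lemma right_ideal_cases I : right_ideal I ->
  [\/ I = [set 0], I = D, I = rideal (x * x) | I = setT].
Proof.
rewrite zero_divisors_rideal; apply: right_ideal_chain => // u.
rewrite -zero_divisors_rideal.
by have [|/right_invertible] := pselect (D u); [left | right].
Qed.

(** Since [Rx = xR], left cofactors move to the right past each [x] in turn. *)
Lemma lidealxx_eq_rideal : lideal (x * x) = rideal (x * x).
Proof.
have lr r : lideal x (x * r) by rewrite lideal_eq_rideal; exists r.
have rl r : rideal x (r * x) by rewrite -lideal_eq_rideal; exists r.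
apply/seteqP; split=> _ [r ->].
  have [s rs] := rl r; have [t st] := rl s.
  by exists t; rewrite mulrA rs -mulrA st mulrA.
have [s rs] := lr r; have [t st] := lr s.
by exists t; rewrite -mulrA rs mulrA st mulrA.
Qed.

Lemma zero_divisors_sqr : subgroup_mul D D = lideal (x * x).
Proof.
apply/seteqP; split.
  have lxx := left_ideal_lideal (x * x); have [l0 _ _] := lxx.
  apply: subgroup_mul_ind => // [a b|a b]; first by apply: one_sidedD; left.
  rewrite {1}zero_divisors_lideal zero_divisors_rideal => -[r ->] [s ->].
  rewrite mulrA -(mulrA r) lidealxx_eq_rideal.
  have [t ->] : rideal (x * x) (r * (x * x)).
    by rewrite -lidealxx_eq_rideal; exists r.
  by exists (t * s); rewrite mulrA.
move=> _ [r ->]; rewrite mulrA; apply: mem_subgroup_mul => //.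
exact: zero_divisorMl.
Qed.

(** All four one-sided ideals are two-sided, so a product of two of them is
    again a left ideal, hence again one of the four. *)
Lemma IPO_zero_divisors :
  IPO R = [set [set 0]; D; subgroup_mul D D; [set: R]].
Proof.
have sided I : one_sided I ->
    [\/ I = [set 0], I = D, I = lideal (x * x) | I = setT].
  case=> [/left_ideal_cases //|/right_ideal_cases].
  by rewrite lidealxx_eq_rideal.
have leftI I : one_sided I -> left_ideal I.
  case/sided=> ->; try exact: left_ideal_lideal.
  - have -> : [set 0] = lideal (0 : R).
      apply/seteqP; split=> [_ ->|_ [r ->]]; first exact: mem_lideal.
      by rewrite mulr0.
    exact: left_ideal_lideal.
  - exact: left_ideal_zero_divisors.
  - exact: left_ideal_setT.
apply/seteqP; split=> A.
  move=> [I [J [/leftI sI _ ->]]]; rewrite zero_divisors_sqr.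
  have [] := sided (subgroup_mul I J).
  - by left; apply: left_ideal_subgroup_mul.
  - by left; left; left.
  - by left; left; right.
  - by left; right.
  - by right.
case=> [[[->|->]|->]|->].
- apply: IPO_one_sided; left.
  by split=> // [_ _ -> ->|r _ ->] /=; rewrite ?subr0 ?mulr0.
- by apply: IPO_one_sided; left; apply: left_ideal_zero_divisors.
- apply: IPO_one_sided; left.
  by apply: left_ideal_subgroup_mul; apply: left_ideal_zero_divisors.
- by apply: IPO_one_sided; left; apply: left_ideal_setT.
Qed.

(** Elements outside [D] are left invertible, so [D] contains every proper
    left ideal. *)
Lemma local_zero_divisors : local_with_maximal_ideal D.
Proof.
have lD := left_ideal_zero_divisors.
have proper I : left_ideal I -> I <> setT -> I `<=` D.
  move=> [_ _ Im] nT u Iu; apply: contrapT => /left_invertible[w wu].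
  apply: nT; apply/seteqP; split=> // r _.
  by rewrite -[r]mulr1 -wu mulrA; apply: Im.
have DT : D <> setT.
  move=> DT; have : D 1 by rewrite DT.
  by move=> /zero_divisor_cube0; rewrite !mulr1.
split=> [|m' [lm' nT /(_ D lD) maxm']].
  split=> // I lI DI; have [->|nT] := pselect (I = setT); first by right.
  by left; apply/seteqP; split=> //; apply: proper.
by case: (maxm' (proper _ lm' nT)).
Qed.

End Generator.

Lemma local_of_zero_divisors x y : D x -> D y -> x * y <> 0 ->
  exists m : set R, local_with_maximal_ideal m /\
    IPO R = [set [set 0]; m; subgroup_mul m m; [set: R]].
Proof.
move=> Dx Dy /(zero_divisor_sqr_neq0 Dx Dy)[z Dz zz]; exists D; split.
  exact: local_zero_divisors Dz zz.
exact: IPO_zero_divisors Dz zz.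
Qed.

End Nil.
End Complete.

Theorem theorem3p4 (R : pzRingType) :
  complete_graph (APOG R) <->
  [\/ (forall x y : R, zero_divisors R x -> zero_divisors R y -> x * y = 0),
      (exists (D1 D2 : pzRingType) (f : {rmorphism R -> (D1 * D2)%type}),
         [/\ is_division_ring D1, is_division_ring D2 & bijective f])
    | (exists m : set R,
         local_with_maximal_ideal m /\
         IPO R = [set [set 0]; m; subgroup_mul m m; [set: R]])].
Proof.
split=> [cR|[|[D1 [D2 [f [d1 d2 bf]]]]|[m [_ IPOE]]]]; first last.
- exact: complete_IPO_chain IPOE.
- exact: complete_division_product d1 d2 bf.
- exact: complete_zero_divisors_sqr0.
have [[e ne]|nidem] := pselect (exists e : R, nontrivial_idempotent e).
  by constructor 2; apply: idempotent_division_product ne.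
have [|] := pselect (forall x y : R,
  zero_divisors R x -> zero_divisors R y -> x * y = 0); first by constructor 1.
move=> /existsNP[x /existsNP[y /not_implyP[Dx /not_implyP[Dy xy]]]].
constructor 3; apply: (local_of_zero_divisors cR _ _ Dx Dy xy) => [e ne|R1].
  by apply: nidem; exists e.
by apply: xy; rewrite -[x]mul1r R1 !mul0r.
Qed.
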